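(* Let $A$ be a finite set. For each $a\in A$, let $P_a$ be a nonempty metric space, and let $\kappa_a$ be a nonzero cardinal. Let $X:=\prod_{a\in A}P_a^{\kappa_a}$ with the supremum metric, assumed finite-valued. If every $\kappa_a$ is infinite, then $X$ is isometric to $X\times_\infty X$.
   Context: $P^\kappa$ denotes the product of $\kappa$ copies of $P$. Products carry the supremum metric $d((x_i),(y_i))=\sup_id_i(x_i,y_i)$, and are regarded as metric spaces only when this is finite on every pair of points. $X\times_\infty X$ is the binary product with metric $\max\{d(x,x'),d(y,y')\}$. Isometries are bijective. *)

(* Defs.v *)
From HB Require Import structures.
From mathcomp Require Import all_boot all_order all_algebra.
From mathcomp Require Import all_classical all_reals all_analysis.

Set Implicit Arguments.
Unset Strict Implicit.
Unset Printing Implicit Defensive.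

Import Order.TTheory GRing.Theory Num.Theory.

Local Open Scope classical_set_scope.
Local Open Scope ring_scope.

(* A set with a metric that may take the value +oo: an arbitrary supremum
   product of metric spaces is of this kind. *)
Record emetric (R : realType) := EMetric {
  esort :> Type ;
  emdist : esort -> esort -> \bar R ;
  emdist_ge0 : forall x y, (0%:E <= emdist x y)%E ;
  emdistxx : forall x, emdist x x = 0%:E ;
  emdist_positivity : forall x y, emdist x y = 0%:E -> x = y ;
  emdist_sym : forall x y, emdist x y = emdist y x ;
  emdist_triangle : forall y x z, (emdist x z <= emdist x y + emdist y z)%E
}.

Section of_metric.
Context {R : realType} (M : metricType R).

Definition mdistE (x y : M) : \bar R := (mdist x y)%:E.

Fact mdistE_ge0 x y : (0%:E <= mdistE x y)%E.
Proof. by rewrite lee_fin mdist_ge0. Qed.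

Fact mdistExx x : mdistE x x = 0%:E.
Proof. by rewrite /mdistE mdistxx. Qed.

Fact mdistE_positivity x y : mdistE x y = 0%:E -> x = y.
Proof. by move=> [] /mdist_positivity. Qed.

Fact mdistE_sym x y : mdistE x y = mdistE y x.
Proof. by rewrite /mdistE metric_sym. Qed.

Fact mdistE_triangle y x z : (mdistE x z <= mdistE x y + mdistE y z)%E.
Proof. by rewrite -EFinD lee_fin metric_triangle. Qed.

Definition of_metric : emetric R :=
  EMetric mdistE_ge0 mdistExx mdistE_positivity mdistE_sym mdistE_triangle.

End of_metric.

Section sup_prod.
Context {R : realType} (I : Type) (E : I -> emetric R).
Implicit Types x y z : forall i, E i.

(* The supremum is taken in [0, +oo], so that it is 0 when I is empty
   (ereal_sup set0 is -oo). *)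
Definition sup_edist x y : \bar R :=
  ereal_sup (0%:E |` range (fun i => emdist (x i) (y i))).

Lemma le_sup_edist x y i : (emdist (x i) (y i) <= sup_edist x y)%E.
Proof. by apply: ereal_sup_ubound; right; exists i. Qed.

Lemma sup_edist_ge0 x y : (0%:E <= sup_edist x y)%E.
Proof. by apply: ereal_sup_ubound; left. Qed.

Lemma sup_edist_le x y r : (0%:E <= r)%E ->
  (forall i, (emdist (x i) (y i) <= r)%E) -> (sup_edist x y <= r)%E.
Proof.
by move=> r0 h; apply: ge_ereal_sup => _ [->//|[i _ <-]]; exact: h.
Qed.

Fact sup_edistxx x : sup_edist x x = 0%:E.
Proof.
apply/eqP; rewrite eq_le sup_edist_ge0 andbT.
by apply: sup_edist_le => // i; rewrite emdistxx.
Qed.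

Fact sup_edist_positivity x y : sup_edist x y = 0%:E -> x = y.
Proof.
move=> xy; apply: functional_extensionality_dep => i.
apply: emdist_positivity; apply/eqP.
by rewrite eq_le emdist_ge0 andbT -xy le_sup_edist.
Qed.

Fact sup_edist_sym x y : sup_edist x y = sup_edist y x.
Proof.
by rewrite /sup_edist; under eq_fun => i do rewrite emdist_sym.
Qed.

Fact sup_edist_triangle y x z :
  (sup_edist x z <= sup_edist x y + sup_edist y z)%E.
Proof.
apply: sup_edist_le => [|i]; first by rewrite adde_ge0 ?sup_edist_ge0.
by rewrite (le_trans (emdist_triangle (y i) _ _))// leeD ?le_sup_edist.
Qed.

Definition sup_prod : emetric R :=
  EMetric sup_edist_ge0 sup_edistxx sup_edist_positivity sup_edist_sym
    sup_edist_triangle.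

End sup_prod.

(* The cardinal exponent kappa is represented by an index type K of that
   cardinality. *)
Definition sup_pow {R : realType} (M : metricType R) (K : Type) : emetric R :=
  sup_prod (fun _ : K => of_metric M).

Definition finite_valued {R : realType} (E : emetric R) : Prop :=
  forall x y : E, emdist x y \is a fin_num.

Definition metric_space_of {R : realType} (E : emetric R)
  (finE : finite_valued E) : Type := esort E.

Section metric_space_of.
Context {R : realType} (E : emetric R) (finE : finite_valued E).
Local Notation M := (metric_space_of finE).

HB.instance Definition _ := gen_eqMixin M.
HB.instance Definition _ := gen_choiceMixin M.

Let dist (x y : M) : R := fine (emdist (x : E) y).

Let distE (x y : M) : (dist x y)%:E = emdist (x : E) y.
Proof. by rewrite fineK// finE. Qed.

Let distxx x : dist x x = 0.
Proof. by rewrite /dist emdistxx. Qed.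

Let dist_positivity x y : dist x y = 0 -> x = y.
Proof. by move=> xy; apply: emdist_positivity; rewrite -distE xy. Qed.

Let dist_sym x y : dist x y = dist y x.
Proof. by rewrite /dist emdist_sym. Qed.

Let dist_triangle y x z : dist x z <= dist x y + dist y z.
Proof. by rewrite -lee_fin EFinD !distE emdist_triangle. Qed.

HB.instance Definition _ :=
  isMetric.Build R M distxx dist_positivity dist_sym dist_triangle.

Lemma mdist_metric_space_of (x y : M) : mdist x y = fine (emdist (x : E) y).
Proof. by []. Qed.

End metric_space_of.

(* The library makes (U * V)%type a pseudometric space with product balls;
   this adds the corresponding distance. *)
Section prod_metric.
Context {R : realType} (U V : metricType R).

Definition max_dist (x y : U * V) : R :=
  Num.max (mdist x.1 y.1) (mdist x.2 y.2).

Let max_dist_ge0 x y : 0 <= max_dist x y.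
Proof. by rewrite le_max mdist_ge0. Qed.

Let max_dist_positivity x y : max_dist x y = 0 -> x = y.
Proof.
case: x y => [x1 x2] [y1 y2] /eqP; rewrite eq_le ge_max /= => /andP[/andP[h1 h2] _].
by congr pair; apply: mdist_positivity; apply/eqP; rewrite eq_le mdist_ge0 ?h1 ?h2.
Qed.

Let ballE_max_dist x d : ball x d = [set y | max_dist x y < d].
Proof.
apply/seteqP; split=> y; rewrite /ball /= /prod_ball !ballEmdist /max_dist gt_max.
  by move=> [/= -> ->].
by move=> /andP[].
Qed.

HB.instance Definition _ := PseudoMetric_isMetric.Build R (U * V)%type
  max_dist_ge0 max_dist_positivity ballE_max_dist.

Lemma mdist_prod (x y : U * V) :
  mdist x y = Num.max (mdist x.1 y.1) (mdist x.2 y.2).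
Proof. by []. Qed.

End prod_metric.

Definition isometric {R : realType} (M N : metricType R) : Prop :=
  exists f : M -> N,
    bijective f /\ forall x y, mdist (f x) (f y) = mdist x y.

(* Main.v *)
Require Import Defs.
From mathcomp Require Import all_boot all_order all_algebra.
From mathcomp Require Import all_classical all_reals all_analysis.

(** An infinite cardinal satisfies kappa + kappa = kappa. A bijection
    [bool * kappa a -> kappa a] splits the coordinates of [P a ^ kappa a] into
    two families, each again indexed by [kappa a]. Doing this for all [a] at
    once splits a point of X into a pair of points of X, bijectively, and a
    supremum over all coordinates is the maximum of the suprema over the two
    halves, so the splitting is an isometry onto the max product.

    The cardinal identity is obtained without ordinals. Zorn's lemma gives a
    maximal disjoint family of countably infinite subsets of K; by maximality
    only finitely many points of K are left over, and they can be added to any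
    one member of the family. So K is partitioned into countably infinite
    blocks ([infinite_countable_partition]). On one block B there is an
    injection from [bool * B] to B because [bool * B] is countable, and these
    injections glue to one from [bool * K] to K. The Cantor-Bernstein theorem
    then yields the bijection ([infinite_bool_prod]). *)

Import Order.TTheory.

Local Open Scope classical_set_scope.

(** * Doubling an infinite set *)

(** The partition is encoded by a labelling of the points by subsets of K,
    the blocks being the fibres. The label of a point is the member of a
    maximal disjoint family that contains it, or one fixed member [B0] for
    the finitely many points outside the union; a fibre thus lies between
    a member of the family and that member plus a finite set. *)
Lemma infinite_countable_partition (K : Type) : infinite_set [set: K] ->
  exists c : K -> set K, forall x,
    countable (c @^-1` [set c x]) /\ infinite_set (c @^-1` [set c x]).
Proof.
elim/Ppointed: K => K; first by rewrite emptyE => /(_ (finite_set0 _)).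
move=> infK.
pose D := [set B : set K | countable B /\ infinite_set B].
have [F [FD tF maxF]] := ex_maximal_disjoint_subcollection id D.
pose U := \bigcup_(B in F) B.
(* An infinite complement would contain one more countably infinite set [B],
   disjoint from all members of [F]. *)
have finCU : finite_set (~` U).
  apply: contrapT => infCU.
  have /infiniteP/pcard_leP/injfunPex[f fU f_inj] := infCU.
  pose B := range f.
  have BU : B `<=` ~` U by move=> _ [n _ <-]; exact: fU.
  have BD : D B.
    have eqB : (B #= [set: nat])%card by exact: inj_card_eq.
    split; first by rewrite (eq_countable eqB).
    by apply/infiniteP; rewrite (card_le_eqr eqB).
  have disjB C : F C -> C `&` B = set0.
    move=> FC; rewrite -subset0 => x [Cx /BU]; apply.
    by exists C.
  have nFB : ~ F B.
    move=> /disjB; rewrite setIid => B0.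
    by case: BD => _; rewrite B0; apply; exact: finite_set0.
  apply: (maxF (B |` F)).
  - split; first by move=> C FC; right.
    by move=> /(_ B (or_introl erefl)).
  - by move=> C [->//|/FD].
  - move=> C1 C2 [->|FC1] [->|FC2] //.
    + by rewrite setIC disjB // => -[].
    + by rewrite disjB // => -[].
    + exact: tF.
have [B0 FB0] : exists B, F B.
  apply: contrapT => nF; apply: infK; rewrite -(setUv U).
  rewrite finite_setU; split=> //.
  suff -> : U = set0 by exact: finite_set0.
  by rewrite -subset0 => x [B FB _]; apply: nF; exists B.
pose member x B := (F B /\ B x) \/ (~ U x /\ B = B0).
have /choice[c cP] : forall x, exists B, member x B.
  move=> x; have [[B FB Bx]|nUx] := pselect (U x).
    by exists B; left.
  by exists B0; right.
exists c => x; have Fc : F (c x) by case: (cP x) => [[]|[_ ->]].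
have [ctx infx] := FD _ Fc.
(* Members of [F] that meet are equal, so a point of [c x] has label [c x]. *)
have sub_fibre : c x `<=` c @^-1` [set c x].
  move=> y cxy; case: (cP y) => [[Fcy cyy]|[nUy _]].
    by apply: (tF _ _ Fcy Fc); exists y.
  by case: nUy; exists (c x).
have fibre_sub : c @^-1` [set c x] `<=` c x `|` ~` U.
  move=> y /= <-; case: (cP y) => [[]|[]]; first by left.
  by right.
split; last by move/(sub_finite_set sub_fibre).
apply: (sub_countable (subset_card_le fibre_sub)).
rewrite -bigcup2E; apply: bigcup_countable => // -[|[|n]] _ //=.
exact: finite_set_countable.
Qed.

Lemma infinite_bool_prod (K : Type) : infinite_set [set: K] ->
  exists e : bool * K -> K, bijective e.
Proof.
elim/Ppointed: K => K; first by rewrite emptyE => /(_ (finite_set0 _)).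
move=> /infinite_countable_partition[c cP].
have /choice[h hP] : forall B : set K, exists h : bool * K -> K,
    (exists x, B = c x) ->
    set_fun (setT `*` c @^-1` [set B]) (c @^-1` [set B]) h /\
    set_inj (setT `*` c @^-1` [set B]) h.
  (* [snd] is a dummy value for the sets that label no point. *)
  move=> B; have [[x ->]|nB] := pselect (exists x, B = c x); last first.
    by exists snd.
  have [ctx /infiniteP infx] := cP x.
  have /pcard_leP/injfunPex[h h1 h2] : (([set: bool] `*` c @^-1` [set c x]) #<=
      (c @^-1` [set c x]))%card.
    exact: card_le_trans (countableX (countableP _) ctx) infx.
  by exists h.
pose g (p : bool * K) := h (c p.2) p.
have cg p : c (g p) = c p.2.
  by have [+ _] := hP _ (ex_intro _ p.2 erefl); apply.
(* [g] preserves labels, so points with equal images lie in one block, where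
   [g] is a single injection. *)
have g_inj : injective g.
  move=> p q gpq; have cpq : c p.2 = c q.2 by rewrite -cg gpq cg.
  have [_] := hP _ (ex_intro _ q.2 erefl); apply; rewrite ?inE //.
  by move: gpq; rewrite /g cpq.
have le1 : ([set: bool * K] #<= [set: K])%card.
  by apply/pcard_leP/injfunPex; exists g => // p q _ _ /g_inj.
have le2 : ([set: K] #<= [set: bool * K])%card.
  by apply/pcard_leP/injfunPex; exists (pair true) => // p q _ _ [].
have /card_set_bijP[e] := Cantor_Bernstein le1 le2.
by rewrite setTT_bijective; exists e.
Qed.

(** * Suprema over coordinates *)

Lemma sup_edist_leP {R : realType} (I : Type) (E : I -> emetric R)
    (x y : sup_prod E) (r : \bar R) : (0%:E <= r)%E ->
  (emdist x y <= r)%E <-> forall i, (emdist (x i) (y i) <= r)%E.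
Proof.
move=> r0; split=> [xyr i|]; last exact: sup_edist_le.
exact: le_trans (le_sup_edist x y i) xyr.
Qed.

Lemma sup_edist_iter_leP {R : realType} (I : Type) (K : I -> Type)
    (E : forall i, K i -> emetric R)
    (x y : sup_prod (fun i => sup_prod (E i))) (r : \bar R) : (0%:E <= r)%E ->
  (emdist x y <= r)%E <-> forall i k, (emdist (x i k) (y i k) <= r)%E.
Proof.
move=> r0; rewrite sup_edist_leP //.
by split=> xyr i; [apply/sup_edist_leP | apply/sup_edist_leP].
Qed.

(** Both sides have the same upper bounds: the coordinates on the left are,
    through the surjections [e i], those of the two halves on the right. *)
Lemma sup_edist_split {R : realType} (I : Type) (K : I -> Type)
    (E : I -> emetric R) (e : forall i, bool * K i -> K i)
    (x y : sup_prod (fun i => sup_prod (fun _ : K i => E i))) :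
  (forall i, bijective (e i)) ->
  let half b (z : sup_prod (fun i => sup_prod (fun _ : K i => E i))) :
    sup_prod (fun i => sup_prod (fun _ : K i => E i)) :=
    fun i k => z i (e i (b, k)) in
  emdist x y = maxe (emdist (half true x) (half true y))
                    (emdist (half false x) (half false y)).
Proof.
move=> e_bij half; apply/eqP; rewrite eq_le; apply/andP; split.
  apply/sup_edist_iter_leP => [|i k]; first by rewrite le_max emdist_ge0.
  have [d _ dK] := e_bij i.
  rewrite -(dK k); case: (d k) => b k'; rewrite le_max.
  have /sup_edist_iter_leP := lexx (emdist (half b x) (half b y)).
  by move=> /(_ (emdist_ge0 _ _) i k'); case: b => ->; rewrite ?orbT.
have /sup_edist_iter_leP coord := lexx (emdist x y).
rewrite ge_max; apply/andP; split;
  by apply/sup_edist_iter_leP => [|i k];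
    [exact: emdist_ge0 | exact/coord/emdist_ge0].
Qed.

Theorem theorem4p81 (R : realType) (A : finType) (P : A -> metricType R)
    (P_nonempty : forall a : A, inhabited (P a))
    (kappa : A -> Type)
    (kappa_nonzero : forall a : A, inhabited (kappa a))
    (X_finite : finite_valued (sup_prod (fun a : A => sup_pow (P a) (kappa a))))
    (kappa_infinite : forall a : A, infinite_set [set: kappa a]) :
  isometric (metric_space_of X_finite)
            (metric_space_of X_finite * metric_space_of X_finite)%type.
Proof.
have e_ex a : {e : bool * kappa a -> kappa a | bijective e}.
  exact/cid/infinite_bool_prod.
pose e a := sval (e_ex a).
have e_bij a : bijective (e a) := svalP (e_ex a).
have d_ex a : {d : kappa a -> bool * kappa a | cancel (e a) d & cancel d (e a)}.
  by apply: cid2; have [d] := e_bij a; exists d.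
pose d a := s2val (d_ex a).
have eK a : cancel (e a) (d a) := s2valP (d_ex a).
have dK a : cancel (d a) (e a) := s2valP' (d_ex a).
pose X := metric_space_of X_finite.
pose half b (x : X) : X := fun a k => x a (e a (b, k)).
pose merge (p : X * X) : X :=
  fun a k => if (d a k).1 then p.1 a (d a k).2 else p.2 a (d a k).2.
exists (fun x => (half true x, half false x)); split.
  exists merge => [x | [x y]].
    apply: functional_extensionality_dep => a; apply/funext => k.
    rewrite /merge /half /= -[in RHS](dK a k).
    by case: (d a k) => -[].
  by congr pair; apply: functional_extensionality_dep => a; apply/funext => k;
    rewrite /merge /half /= eK.
move=> x y; rewrite mdist_prod !mdist_metric_space_of /=.
apply: EFin_inj; rewrite fine_max ?X_finite // fineK ?X_finite //; apply/esym.
exact: (@sup_edist_split R A kappa (fun a => of_metric (P a)) e x y e_bij).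
Qed.
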